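(* For all $n\geq 1$, the number of desarrangements of length $n$ avoiding each of $231$, $312$, and $321$ is $d_n(231,312,321)=f_{n-1}$, the $(n-1)$st Fibonacci number.
   Context: Permutations are in one-line notation. An index $i\in[n-1]$ is a descent of $\pi\in\mathfrak{S}_n$ if $\pi_i>\pi_{i+1}$; $i\in[n]$ is an ascent if it is not a descent (so $n$ is always an ascent). A desarrangement is a permutation whose first ascent is even. $d_n(\Pi)$ is the number of desarrangements in $\mathfrak{S}_n$ avoiding every pattern in $\Pi$ ($\pi$ avoids $\sigma$ if no subsequence of $\pi$ has the same relative order as $\sigma$). Fibonacci numbers: $f_0=0$, $f_1=1$, $f_n=f_{n-1}+f_{n-2}$ for $n\ge2$. *)

(* Defs.v *)
From mathcomp Require Import all_boot all_fingroup.

Set Implicit Arguments.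
Unset Strict Implicit.
Unset Printing Implicit Defensive.

(* Positions and values of s : 'S_n are 0-based: the ordinal i stands for the
   index i.+1 of [n].  In particular the last ordinal, having no successor, is
   never a descent. *)

Definition is_descent (n : nat) (s : 'S_n) (i : 'I_n) : bool :=
  [exists j : 'I_n, (j == i.+1 :> nat) && (s j < s i)].

Definition is_ascent (n : nat) (s : 'S_n) (i : 'I_n) : bool :=
  ~~ is_descent s i.

Definition is_first_ascent (n : nat) (s : 'S_n) (i : 'I_n) : bool :=
  is_ascent s i && [forall j : 'I_n, is_ascent s j ==> (i <= j)].

(* i.+1 is the 1-based index of the first ascent. *)
Definition desarrangement (n : nat) (s : 'S_n) : bool :=
  [exists i : 'I_n, is_first_ascent s i && ~~ odd i.+1].

(* A pattern p is given by its one-line notation; f lists the positions of a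
   subsequence of s with the same relative order as p. *)
Definition contains (n : nat) (s : 'S_n) (p : seq nat) : bool :=
  [exists f : {ffun 'I_(size p) -> 'I_n},
    [forall i : 'I_(size p), forall j : 'I_(size p), (i < j) ==> (f i < f j)] &&
    [forall i : 'I_(size p), forall j : 'I_(size p),
      (s (f i) < s (f j)) == (nth 0 p i < nth 0 p j)]].

Definition avoids (n : nat) (s : 'S_n) (p : seq nat) : bool :=
  ~~ contains s p.

Definition num_desarr (n : nat) (Pi : seq (seq nat)) : nat :=
  #|[set s : 'S_n | desarrangement s && all (avoids s) Pi]|.

Fixpoint fib (n : nat) : nat :=
  match n with
  | 0 => 0
  | 1 => 1
  | (m.+1 as k).+1 => fib k + fib m
  end.

(* Main.v *)
Require Import Defs.
From mathcomp Require Import all_boot all_fingroup.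
From mathcomp Require Import zify.

(** A permutation avoids 231, 312 and 321 exactly when it has no inversion
    between positions at distance at least two: whatever the value at a position
    strictly in between, such an inversion extends to one of the three patterns.
    Such a permutation starts with the block 1 or with the block 21, and removing
    that block gives a bijection onto the shorter permutations of this kind, so
    there are [fib n.+1] of them.  Those starting with 1 have first ascent 1, and
    those starting with 21 have first ascent 2; hence the desarrangements of
    length [n.+2] are counted by [fib n.+1]. *)

Set Implicit Arguments.
Unset Strict Implicit.
Unset Printing Implicit Defensive.

Lemma perm_val_neq n (s : 'S_n) (u v : 'I_n) : u < v -> (s u : nat) != s v.
Proof. by move=> uv; rewrite (inj_eq val_inj) (inj_eq perm_inj) -val_eqE neq_ltn uv. Qed.

(** Three comparisons suffice: both the pattern entries and the values of [s] are pairwise distinct,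
    so each comparison settles the reversed one. *)
Lemma contains3P n (s : 'S_n) (x y z : nat) : uniq [:: x; y; z] ->
  reflect (exists a b c : 'I_n,
             [/\ a < b, b < c, (s a < s b) = (x < y), (s a < s c) = (x < z)
               & (s b < s c) = (y < z)])
          (contains s [:: x; y; z]).
Proof.
move=> xyz_uniq; apply: (iffP existsP) => [[f /andP[/forallP fM /forallP fs]]|].
  pose i0 : 'I_3 := ord0; pose i1 : 'I_3 := lift ord0 ord0.
  pose i2 : 'I_3 := lift ord0 (lift ord0 ord0).
  have {}fM (i j : 'I_3) : i < j -> f i < f j.
    by move=> ij; exact: (implyP (forallP (fM i) j)).
  have {}fs (i j : 'I_3) : (s (f i) < s (f j)) = (nth 0 [:: x; y; z] i < nth 0 [:: x; y; z] j).
    by have /forallP/(_ j)/eqP := fs i.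
  exists (f i0), (f i1), (f i2); split.
  - exact: fM.
  - exact: fM.
  - exact: fs i0 i1.
  - exact: fs i0 i2.
  - exact: fs i1 i2.
case=> a [b [c [ab bc sab sac sbc]]].
have sab' := perm_val_neq s ab; have sbc' := perm_val_neq s bc.
have sac' := perm_val_neq s (ltn_trans ab bc).
move: xyz_uniq; rewrite /= !inE => xyz_uniq.
exists [ffun i : 'I_3 => nth a [:: a; b; c] i].
apply/andP; split; apply/forallP => -[[|[|[|//]]] Hi];
  apply/forallP => -[[|[|[|//]]] Hj]; rewrite !ffunE //=; try lia;
  apply/eqP; lia.
Qed.

Definition far_increasing n (s : 'S_n) : bool :=
  [forall a : 'I_n, forall c : 'I_n, (a.+1 < c) ==> (s a < s c)].

Lemma far_increasingP n (s : 'S_n) :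
  reflect (forall a c : 'I_n, a.+1 < c -> s a < s c) (far_increasing s).
Proof.
apply: (iffP forallP) => [Hs a c|Hs a]; first by move: (forallP (Hs a) c) => /implyP.
by apply/forallP => c; apply/implyP/Hs.
Qed.

Lemma avoids_far_increasing n (s : 'S_n) :
  all (avoids s) [:: [:: 2; 3; 1]; [:: 3; 1; 2]; [:: 3; 2; 1]] = far_increasing s.
Proof.
apply/idP/far_increasingP => [/and4P[av231 av312 av321 _] a c ac|Hs].
  rewrite ltnNge; apply/negP => sca.
  have ltbn : a.+1 < n by apply: ltn_trans (ltn_ord c).
  (* The position [b] right after [a] lies before [c]. As [s c < s a], a value [s b] above both
     gives 231, one between them 321 and one below both 312; the last two cases are separated by
     comparing [s b] with [s c]. *)
  pose b := Ordinal ltbn.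
  have sab := @perm_val_neq _ s a b (ltnSn a); have sbc := @perm_val_neq _ s b c ac.
  have sac := @perm_val_neq _ s a c (ltnW ac).
  have [ltab|leba] := ltnP (s a) (s b).
    by case/contains3P: av231 => //; exists a, b, c; split=> //=; lia.
  have [ltbc|lecb] := ltnP (s b) (s c).
    by case/contains3P: av312 => //; exists a, b, c; split=> //=; lia.
  by case/contains3P: av321 => //; exists a, b, c; split=> //=; lia.
(* Each of the three patterns has its first entry above its third, so an occurrence is an inversion
   at distance at least two. *)
by rewrite /= !andbT; apply/and3P; split; apply/contains3P => // -[a [b [c []]]] ab bc;
  have /Hs : a.+1 < c by [lia]; move=> /= -> _.
Qed.

Lemma lift_perm_inj n (i j : 'I_n.+1) : injective (@lift_perm n i j).
Proof.
move=> s t st; apply/permP => k; apply: (@lift_inj _ j).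
by rewrite -!(lift_perm_lift i) st.
Qed.

(** Deleting position [i] and value [j] from [s] leaves a smaller permutation. With [lift_perm_inj],
    this makes [lift_perm i j] a bijection onto the permutations sending [i] to [j]. *)
Lemma lift_perm_surj n (i j : 'I_n.+1) (s : 'S_n.+1) :
  s i = j -> exists t, s = lift_perm i j t.
Proof.
move=> sij.
have /fin_all_exists[f fE] k : exists k', s (lift i k) = lift j k'.
  have neq : j != s (lift i k) by rewrite -sij (inj_eq perm_inj) neq_lift.
  by have [k' ->] := unlift_some neq; exists k'.
have f_inj : injective f.
  by move=> k l fkl; apply/(@lift_inj _ i)/(@perm_inj _ s); rewrite !fE fkl.
exists (perm f_inj); apply/permP => k.
have [k' ->|->] := unliftP i k; last by rewrite lift_perm_id.
by rewrite lift_perm_lift permE fE.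
Qed.

Lemma far_increasing_head1 n (t : 'S_n) :
  far_increasing (lift_perm ord0 ord0 t) = far_increasing t.
Proof.
apply/far_increasingP/far_increasingP => Ht a c ac.
  by have := Ht (lift ord0 a) (lift ord0 c) ac; rewrite !lift_perm_lift.
have [c' cE|c0] := unliftP ord0 c; last by move: ac; rewrite c0.
have [a' aE|->] := unliftP ord0 a; last by rewrite cE lift_perm_id lift_perm_lift.
by move: ac; rewrite aE cE !lift_perm_lift; apply: Ht.
Qed.

(** The nested lifts prepend the block 21 and raise every value of [t] by two. The only inversion
    this adds is between the two adjacent leading positions. *)
Lemma far_increasing_head21 n (t : 'S_n) :
  far_increasing (lift_perm ord0 (lift ord0 ord0) (lift_perm ord0 ord0 t)) =
  far_increasing t.
Proof.
set s := lift_perm _ _ _.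
have s0 : s ord0 = 1 :> nat by rewrite lift_perm_id.
have s1 : s (lift ord0 ord0) = 0 :> nat by rewrite lift_perm_lift lift_perm_id.
have sSS k : s (lift ord0 (lift ord0 k)) = (t k).+2 :> nat.
  by rewrite !lift_perm_lift.
apply/far_increasingP/far_increasingP => Ht a c ac.
  by have := Ht (lift ord0 (lift ord0 a)) (lift ord0 (lift ord0 c)) ac; rewrite !sSS.
have [c1 c1E|c0] := unliftP ord0 c; last by move: ac; rewrite c0.
have [c2 c2E|c0] := unliftP ord0 c1; last by move: ac; rewrite c1E c0.
have [a1 a1E|->] := unliftP ord0 a; last by rewrite c1E c2E s0 sSS.
have [a2 a2E|a10] := unliftP ord0 a1; last by rewrite a1E a10 c1E c2E s1 sSS.
by move: ac; rewrite a1E a2E c1E c2E !sSS; apply: Ht.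
Qed.

(** The least value, being absent from the first position, would form a far inversion with it from
    the third position on, so it is second. The next value must then be first: from the third
    position on it would force [s ord0] to be 0. *)
Lemma far_increasing_head n (s : 'S_n.+2) : far_increasing s -> s ord0 != ord0 ->
  s ord0 = lift ord0 ord0 /\ s (lift ord0 ord0) = ord0.
Proof.
move=> /far_increasingP Hs s0.
have s1 : s (lift ord0 ord0) = ord0.
  have := permKV s ord0; set p := (s^-1)%g ord0 => sp.
  have [p1 p1E|p0] := unliftP ord0 p; last by move: s0; rewrite -{1}p0 sp eqxx.
  have [p2 p2E|p10] := unliftP ord0 p1; last by rewrite -p10 -p1E.
  by have := Hs ord0 p; rewrite sp p1E p2E => /(_ isT).
split=> //; have := permKV s (lift ord0 ord0); set q := (s^-1)%g _ => sq.
have [q1 q1E|q0] := unliftP ord0 q; last by rewrite -{1}q0 sq.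
have [q2 q2E|q10] := unliftP ord0 q1; last by move: sq; rewrite q1E q10 s1.
have := Hs ord0 q; rewrite sq q1E q2E => /(_ isT) /=.
by rewrite ltnS leqn0 => /eqP s00; case/eqP: s0; apply: val_inj.
Qed.

Definition num_far_increasing n := #|[set s : 'S_n | far_increasing s]|.

Lemma card_far_increasing_head1 n :
  #|[set s : 'S_n.+1 | far_increasing s & s ord0 == ord0]| = num_far_increasing n.
Proof.
rewrite /num_far_increasing -(card_imset _ (@lift_perm_inj n ord0 ord0)); congr #|pred_of_set _|.
apply/setP => s; rewrite inE; apply/andP/imsetP => [[Hs /eqP s0]|[t]].
  have [t st] := lift_perm_surj s0; exists t => //.
  by rewrite inE -far_increasing_head1 -st.
by rewrite inE => Ht ->; rewrite far_increasing_head1 Ht lift_perm_id.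
Qed.

Lemma card_far_increasing_head21 n :
  #|[set s : 'S_n.+2 | far_increasing s & s ord0 != ord0]| = num_far_increasing n.
Proof.
pose block21 (t : 'S_n) := lift_perm ord0 (lift ord0 ord0) (lift_perm ord0 ord0 t).
have block21_inj : injective block21 by move=> t u /lift_perm_inj /lift_perm_inj.
rewrite /num_far_increasing -(card_imset _ block21_inj); congr #|pred_of_set _|.
apply/setP => s; rewrite inE; apply/andP/imsetP => [[Hs s0]|[t]].
  have [{}s0 s1] := far_increasing_head Hs s0.
  have [u su] := lift_perm_surj s0.
  (* With the first entry removed, the second entry of [s], its least value, leads [u]. *)
  have u0 : u ord0 = ord0.
    apply: (@lift_inj _ (lift ord0 ord0)).
    by rewrite -(lift_perm_lift ord0) -su s1; apply: val_inj.
  have [t ut] := lift_perm_surj u0; exists t; last by rewrite su ut.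
  by rewrite inE -far_increasing_head21 -ut -su.
by rewrite inE => Ht ->; rewrite far_increasing_head21 Ht lift_perm_id.
Qed.

Lemma num_far_increasing_rec n :
  num_far_increasing n.+2 = num_far_increasing n.+1 + num_far_increasing n.
Proof.
rewrite -(card_far_increasing_head1 n.+1) -(card_far_increasing_head21 n).
rewrite /num_far_increasing -(cardsID [set s : 'S_n.+2 | s ord0 == ord0]).
by congr (_ + _); apply: eq_card => s; rewrite !inE // andbC.
Qed.

Lemma num_far_increasing_small n : n <= 1 -> num_far_increasing n = 1.
Proof.
move=> n1; rewrite /num_far_increasing (_ : [set s | _] = [set: 'S_n]).
  by rewrite cardsT card_Sn; case: n n1 => [|[]].
apply/setP => s; rewrite !inE; apply/far_increasingP => a c.
by have := ltn_ord c; lia.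
Qed.

Lemma num_far_increasing_fib n : num_far_increasing n = fib n.+1.
Proof.
suff: num_far_increasing n = fib n.+1 /\ num_far_increasing n.+1 = fib n.+2 by case.
elim: n => [|n [IHn IHn1]]; first by rewrite !num_far_increasing_small.
by split=> //; rewrite num_far_increasing_rec IHn IHn1.
Qed.

(** A position carrying the value 0 is always an ascent. It is either the first position, of odd
    index 1, or the second, of even index 2, preceded by the descent of the block 21. *)
Lemma far_increasing_desarrangement n (s : 'S_n.+2) :
  far_increasing s -> desarrangement s = (s ord0 != ord0).
Proof.
move=> Hs; apply/existsP/idP => [[i /andP[/andP[_ /forallP min_i] even_i]]|s0].
  apply/eqP => s0; have /implyP := min_i ord0.
  have -> : is_ascent s ord0.
    by apply/existsP => -[j]; rewrite s0 andbF.
  by move=> /(_ isT); rewrite leqn0 => /eqP i0; rewrite i0 in even_i.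
have [{}s0 s1] := far_increasing_head Hs s0.
exists (lift ord0 ord0); rewrite andbT; apply/andP; split.
  by apply/existsP => -[j]; rewrite s1 andbF.
apply/forallP => j; apply/implyP; apply: contraNT; rewrite -ltnNge ltnS leqn0 => /eqP j0.
have -> : j = ord0 by apply: val_inj.
by apply/existsP; exists (lift ord0 ord0); rewrite s0 s1.
Qed.

Lemma desarrangement1 (s : 'S_1) : desarrangement s = false.
Proof. by apply/existsP => -[i]; rewrite ord1 andbF. Qed.

Theorem theorem3p27 (n : nat) (hn : 1 <= n) :
  num_desarr n [:: [:: 2; 3; 1]; [:: 3; 1; 2]; [:: 3; 2; 1]] = fib (n - 1).
Proof.
rewrite /num_desarr; case: n hn => [//|[|n] _].
  (* In length 1 the only ascent has index 1, so the count is 0, which is [fib 0]. *)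
  by apply/eqP; rewrite cards_eq0; apply/eqP/setP => s; rewrite !inE desarrangement1.
(* The Fibonacci number is turned back into the count of permutations in ['S_n.+2] with leading
   block 21, so that the two sets can be compared pointwise. *)
rewrite subn1 -num_far_increasing_fib -card_far_increasing_head21.
apply: eq_card => s; rewrite !inE avoids_far_increasing andbC.
by have [/far_increasing_desarrangement ->|] := boolP (far_increasing s).
Qed.
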